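(* If $m_4=\tfrac{14}{15}$, then $m_3=\tfrac45$.
   Context: A cubic bridgeless graph is a graph in which every vertex has degree 3 and each connected component is 2-edge-connected. A perfect matching of $G$ is a set of edges such that every vertex is incident to exactly one of them. For a cubic bridgeless graph $G$ and a positive integer $t$, $m_t(G)$ denotes the maximum, over all choices of $t$ perfect matchings $M_1,\dots,M_t$ of $G$, of $|M_1\cup\dots\cup M_t|/|E(G)|$, and $m_t$ denotes the infimum of $m_t(G)$ over all cubic bridgeless graphs $G$. *)

(* Defs.v *)
From HB Require Import structures.
From mathcomp Require Import all_boot all_order all_algebra.
From mathcomp Require Import all_classical all_reals.

Set Implicit Arguments.
Unset Strict Implicit.
Unset Printing Implicit Defensive.

Import Order.TTheory GRing.Theory Num.Theory.

(* Graphs are finite and simple; they need not be connected. *)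
Record sgraph := SGraph {
  vertex :> finType;
  adj : rel vertex;
  adj_sym : symmetric adj;
  adj_irr : irreflexive adj
}.

Section GraphNotions.
Local Open Scope nat_scope.
Variable G : sgraph.

(* An edge is the set of its two ends. *)
Definition edges : {set {set G}} :=
  [set [set p.1; p.2] | p in [set p : G * G | adj p.1 p.2]].

Definition degree (x : G) : nat := #|[set y | adj x y]|.

Definition component (x : G) : {set G} := [set y | connect (@adj G) x y].

(* Adjacency in G[A] - F. *)
Definition sub_adj (A : {set G}) (F : {set {set G}}) : rel G :=
  [rel u v | [&& u \in A, v \in A, adj u v & [set u; v] \notin F]].

(* The induced subgraph G[A] is k-edge-connected: it has at least two vertices
   and stays connected after the deletion of any fewer than k edges. *)
Definition edge_connected (k : nat) (A : {set G}) : Prop :=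
  1 < #|A| /\
  forall F : {set {set G}}, F \subset edges -> #|F| < k ->
    {in A &, forall x y, connect (sub_adj A F) x y}.

(* The null graph is excluded: the ratio |M_1 U ... U M_t| / |E(G)| would be
   0 / 0, which is 0 by convention in MathComp and would make every infimum
   below equal to 0. *)
Definition cubic_bridgeless : Prop :=
  [/\ 0 < #|G|,
      forall x : G, degree x = 3
    & forall x : G, edge_connected 2 (component x)].

Definition perfect_matching (M : {set {set G}}) : bool :=
  (M \subset edges) && [forall x : G, #|[set f in M | x \in f]| == 1].

(* The maximum of |M_1 U ... U M_t| over families of t perfect matchings, not
   necessarily distinct. (It is 0 when there is no such family, but every cubic
   bridgeless graph has a perfect matching by Petersen's theorem.) *)
Definition max_union (t : nat) : nat :=
  \max_(M : {ffun 'I_t -> {set {set G}}} | [forall i, perfect_matching (M i)])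
    #|\bigcup_(i < t) M i|.

End GraphNotions.

Local Open Scope classical_set_scope.
Local Open Scope ring_scope.

Definition m_graph (R : realType) (t : nat) (G : sgraph) : R :=
  (max_union G t)%:R / #|edges G|%:R.

Definition m_inf (R : realType) (t : nat) : R :=
  inf [set r : R | exists2 G : sgraph, cubic_bridgeless G & r = m_graph R t G].

(* Main.v *)
(* Upper bound: the Petersen graph P has six perfect matchings, any three of
   which cover at most 12 of its 15 edges.

   Lower bound: fix an edge f of P. Replace every edge uv of G by a chain
   u - (P - f) - (P - f) - v; the result H is cubic and bridgeless. Each copy of
   P - f is separated by a 2-edge cut, so a perfect matching M of H uses both
   edges of the cut or none: M induces a perfect matching of P on each copy
   (containing f or not), and a perfect matching of G. If f lies in x of four
   perfect matchings of P, these cover at most c(x) edges of P, with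
   c = 14, 14, 14, 12, 9 for x = 0, ..., 4. So four matchings covering 14/15 of
   the edges of H induce four matchings of G for which few edges of G have
   multiplicity 0, 3 or 4, and then the average triple among these four covers
   at least 4/5 of the edges of G. *)
Require Import Defs.
From HB Require Import structures.
From mathcomp Require Import all_boot all_order all_algebra.
From mathcomp Require Import all_classical all_reals.
(* Gives precedence back to finite sets over classical sets. *)
From mathcomp Require Import fintype finset zify.

Set Implicit Arguments.
Unset Strict Implicit.
Unset Printing Implicit Defensive.

Import Order.TTheory GRing.Theory Num.Theory.

(** * Incidence counts and bridges in finite graphs *)

Lemma set2_inj (T : finType) (x : T) : injective (fun y => [set x; y]).
Proof.
move=> y z E; have: y \in [set x; z] by rewrite -E set22.
have: z \in [set x; y] by rewrite E set22.
by rewrite !inE; do 2!case/orP => /eqP -> //.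
Qed.

Lemma set2_eq (T : finType) (x y u v : T) :
  [set x; y] = [set u; v] -> (x, y) \in [:: (u, v); (v, u)].
Proof.
move=> E; have := set21 x y; rewrite E !inE !xpair_eqE.
case/orP => /eqP ex; move: E; rewrite ex; first by move/set2_inj ->; rewrite !eqxx.
by rewrite (setUC [set u]) => /set2_inj ->; rewrite !eqxx orbT.
Qed.

Section Graphs.
Variable G : sgraph.
Implicit Types (x y u v : G) (S : {set {set G}}).

Lemma adj_neq x y : adj x y -> x != y.
Proof. by apply: contraTneq => ->; rewrite adj_irr. Qed.

Lemma mem_edges x y : ([set x; y] \in edges G) = adj x y.
Proof.
apply/imsetP/idP => [[[u v]]|xy]; last by exists (x, y); rewrite ?inE.
rewrite inE /= => uv E; have := set21 x y; rewrite E !inE.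
case/orP => /eqP ex; move: E; rewrite ex; first by move/set2_inj ->.
by rewrite (setUC [set u]) => /set2_inj ->; rewrite adj_sym.
Qed.

Lemma edgesP (e : {set G}) :
  reflect (exists x y, adj x y /\ e = [set x; y]) (e \in edges G).
Proof.
apply: (iffP idP) => [/imsetP[[u v]]|[x [y [xy ->]]]]; last by rewrite mem_edges.
by rewrite inE => uv ->; exists u, v.
Qed.

Lemma card_edge (e : {set G}) : e \in edges G -> #|e| = 2.
Proof. by case/edgesP=> x [y [/adj_neq xy ->]]; rewrite cards2 xy. Qed.

(** Edges at [x] correspond one to one to neighbours of [x]. Sums over neighbours are the form that
    carries over from the Petersen graph to its copies. *)
Lemma card_incident S x : S \subset edges G ->
  #|[set e in S | x \in e]| = \sum_(y | adj x y) ([set x; y] \in S).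
Proof.
move=> /fintype.subsetP sSE.
have -> : [set e in S | x \in e]
          = [set [set x; y] | y in [set y | adj x y && ([set x; y] \in S)]].
  apply/setP => e; rewrite inE; apply/andP/imsetP => [[eS xe]|[y]]; last first.
    by rewrite inE => /andP[_ yS] ->; rewrite set21.
  have /edgesP[u [v [uv E]]] := sSE _ eS; subst e.
  move: xe; rewrite !inE => /orP[]/eqP ->; first by exists v; rewrite ?inE ?uv.
  by rewrite setUC in eS *; exists u; rewrite ?inE // adj_sym uv.
rewrite card_imset; last exact: set2_inj.
rewrite -sum1_card big_mkcond [RHS]big_mkcond; apply: eq_bigr => y _.
by rewrite inE; case: (adj x y); case: (_ \in S).
Qed.

(** Double counting of the pairs formed by an edge of [S] and one of its ends. Edge counts below are
    made at the ends, hence doubled. *)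
Lemma handshake S : S \subset edges G ->
  \sum_x \sum_(y | adj x y) ([set x; y] \in S) = 2 * #|S|.
Proof.
move=> sSE; under eq_bigr => x _ do rewrite -card_incident // -sum1_card.
rewrite (exchange_big_dep (mem S)) /= => [|x e _]; last by rewrite inE => /andP[].
rewrite mulnC -sum_nat_const; apply: eq_bigr => e eS.
by rewrite -(card_edge (subsetP sSE _ eS)) -sum1_card; apply: eq_bigl => x; rewrite inE eS.
Qed.

Lemma degreeE x : degree x = \sum_(y | adj x y) 1.
Proof. by rewrite /degree -sum1_card; apply: eq_bigl => y; rewrite inE. Qed.

Lemma card_edges_cubic : (forall x, degree x = 3) -> 2 * #|edges G| = 3 * #|G|.
Proof.
move=> G3; rewrite -(handshake (subxx _)) mulnC -sum_nat_const.
by apply: eq_bigr => x _; rewrite -(G3 x) degreeE; apply: eq_bigr => y xy; rewrite mem_edges xy.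
Qed.

Lemma perfect_matchingP S : S \subset edges G ->
  reflect (forall x, \sum_(y | adj x y) ([set x; y] \in S) = 1) (perfect_matching S).
Proof.
move=> sSE; rewrite /perfect_matching sSE.
by apply: (iffP forallP) => H x; have := H x; rewrite -card_incident // => /eqP.
Qed.

Definition del_edge u v : rel G :=
  fun x y => adj x y && ([set x; y] != [set u; v]).

Lemma del_edge_sym u v : connect_sym (del_edge u v).
Proof. by apply: sym_connect_sym => x y; rewrite /del_edge adj_sym setUC. Qed.

(** A set of fewer than two edges is empty or a single edge, and a walk through a deleted edge can
    be rerouted along a detour between its ends. Degree 3 supplies a second vertex in each
    component. *)
Lemma cubic_bridgelessP :
  cubic_bridgeless G <->
  [/\ 0 < #|G|, forall x, degree x = 3
    & forall x y, adj x y -> connect (del_edge x y) x y].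
Proof.
split=> -[G0 G3 Gb]; split=> //.
  move=> x y xy; have [_ /(_ [set [set x; y]])] := Gb x.
  rewrite cards1 sub1set mem_edges xy => /(_ isT isT x y).
  rewrite !inE connect0 connect1 // => /(_ isT isT).
  by apply: connect_sub => a b /and4P[_ _ ab]; rewrite inE => nab; apply: connect1; rewrite /del_edge ab.
move=> x; split.
  have : 0 < degree x by rewrite G3.
  rewrite /degree card_gt0 => /set0Pn[y]; rewrite inE => xy.
  suff : #|[set x; y]| <= #|component x| by rewrite cards2 adj_neq.
  by apply: subset_leq_card; rewrite subUset !sub1set !inE connect0 connect1.
move=> F sFE cF u v; rewrite !inE => xu xv.
have uv : connect (@adj G) u v.
  by apply: connect_trans xv; rewrite sym_connect_sym //; apply: adj_sym.
pose e := [rel a b | adj a b && ([set a; b] \notin F)].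
have euv : connect e u v.
  apply: connect_sub uv => a b ab; case abF: ([set a; b] \in F); last first.
    by apply: connect1; rewrite /= ab abF.
  suff E : e =2 del_edge a b by rewrite (eq_connect E) Gb.
  move=> c d; congr (_ && ~~ _).
  have /cards1P[f Ff] : #|F| == 1.
    by rewrite eqn_leq -ltnS cF card_gt0; apply/set0Pn; exists [set a; b].
  by move: abF; rewrite Ff !inE => /eqP ->.
(* [sub_adj] also asks for both ends in the component, which a walk starting there never leaves. *)
case/connectP: euv => p ep ->; elim: p u xu ep {xv uv} => [|w p IH] u xu /=; first by rewrite connect0.
case/andP=> /andP[uw nF] pw; have xw : connect (@adj G) x w.
  by apply: connect_trans xu (connect1 uw).
by apply: connect_trans (connect1 _) (IH w xw pw); rewrite /sub_adj /= !inE xu xw uw nF.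
Qed.

Lemma max_union3_ge (A B C : {set {set G}}) :
  perfect_matching A -> perfect_matching B -> perfect_matching C ->
  #|A :|: B :|: C| <= max_union G 3.
Proof.
move=> pA pB pC; pose M : {ffun 'I_3 -> {set {set G}}} := [ffun i => tnth [tuple A; B; C] i].
have -> : A :|: B :|: C = \bigcup_(i < 3) M i.
  by rewrite !big_ord_recl big_ord0 !ffunE setU0 setUA.
apply: (@leq_bigmax_cond _ _ (fun N : {ffun 'I_3 -> {set {set G}}} => #|\bigcup_(i < 3) N i|)).
by apply/forallP => i; rewrite ffunE; move: i; apply/(all_tnthP (a := @perfect_matching G)); rewrite /= pA pB pC.
Qed.

(** Positivity rules out the default value 0 of an empty maximum, so some family exists and an
    optimal one can be chosen. *)
Lemma max_union_attained t : 0 < max_union G t ->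
  exists2 M : 'I_t -> {set {set G}},
    forall i, perfect_matching (M i) & #|\bigcup_(i < t) M i| = max_union G t.
Proof.
pose P := [pred M : {ffun 'I_t -> {set {set G}}} | [forall i, perfect_matching (M i)]].
rewrite /max_union => gt0; have [M PM|P0] := pickP P; last by rewrite big_pred0 in gt0.
have [|N PN E] := @eq_bigmax_cond _ P (fun M => #|\bigcup_(i < t) M i|).
  by apply/card_gt0P; exists M.
by exists N => [i|]; [move/forallP: PN | rewrite -E].
Qed.

Lemma max_union4_attained : 0 < max_union G 4 ->
  exists A B C D : {set {set G}}, [/\ perfect_matching A, perfect_matching B, perfect_matching C,
    perfect_matching D & #|A :|: B :|: C :|: D| = max_union G 4].
Proof.
case/max_union_attained => M pM <-; rewrite !big_ord_recl big_ord0 setU0 !setUA.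
by do 4!eexists; split; try exact: pM.
Qed.

Lemma max_union3_attained : 0 < max_union G 3 ->
  exists A B C : {set {set G}}, [/\ perfect_matching A, perfect_matching B, perfect_matching C
    & #|A :|: B :|: C| = max_union G 3].
Proof.
case/max_union_attained => M pM <-; rewrite !big_ord_recl big_ord0 setU0 !setUA.
by do 3!eexists; split; try exact: pM.
Qed.

End Graphs.

(** * Perfect matchings of the Petersen graph *)

(** The edges of P other than f = 01, in one direction each: the path 1 2 3 4 0, the spokes, and the
    pentagram 5 7 9 6 8. *)
Definition inner_arcs : seq (nat * nat) :=
  [:: (1, 2); (2, 3); (3, 4); (4, 0); (0, 5); (1, 6); (2, 7); (3, 8); (4, 9);
      (5, 7); (7, 9); (9, 6); (6, 8); (8, 5)].

Definition inner_adj : rel nat :=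
  fun a b => ((a, b) \in inner_arcs) || ((b, a) \in inner_arcs).

Definition petersen_adj : rel nat :=
  fun a b => [|| inner_adj a b, (a, b) == (0, 1) | (a, b) == (1, 0)].

(* The arc 01 occurs in both directions because in [subst] below its two
   ends are joined to different outside vertices. *)
Definition arcs : seq (nat * nat) := (0, 1) :: inner_arcs ++ [:: (1, 0)].

Definition arc_index (a b : nat) : nat :=
  index (if (a, b) \in arcs then (a, b) else (b, a)) arcs.

(** Incidence table by positions in [arcs]: once [code] has turned a relation into bits, the finite
    checks on matchings are computations on lists. *)
Definition arc_rows : seq (seq nat) :=
  [seq [seq arc_index a b | b <- iota 0 10 & petersen_adj a b] | a <- iota 0 10].

Definition code (g : rel nat) : bitseq := [seq g e.1 e.2 | e <- arcs].

Definition row_sum (f : nat -> nat) (r : seq nat) : nat := sumn [seq f k | k <- r].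

Definition is_matching_code (rows : seq (seq nat)) (s : bitseq) : bool :=
  all (fun r => row_sum (nth false s) r == 1) rows.

Fixpoint bitseqs (n : nat) : seq bitseq :=
  if n is m.+1 then
    let r := bitseqs m in [seq true :: s | s <- r] ++ [seq false :: s | s <- r]
  else [:: [::]].

(** Brute force over the 2^16 bit sequences. Six survive, one for each perfect matching of P. *)
Definition matching_codes : seq bitseq :=
  let rows := arc_rows in [seq s <- bitseqs 16 | is_matching_code rows s].

(** A covered edge inside the copy counts twice, once at each end; the arcs 01 and 10 count once
    each. *)
Definition covered (ss : seq bitseq) : nat :=
  sumn [seq row_sum (fun k => has (nth false ^~ k) ss) r | r <- arc_rows].

Lemma mem_bitseqs s : s \in bitseqs (size s).
Proof.
elim: s => //= b s IH; rewrite mem_cat; case: b; apply/orP; [left | right]; exact: map_f.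
Qed.

Lemma mem_arcs e : (e \in arcs) = [|| e == (0, 1), e \in inner_arcs | e == (1, 0)].
Proof. by rewrite in_cons mem_cat mem_seq1. Qed.

Lemma arcs_neq a b : (a, b) \in arcs -> (b, a) \notin arcs -> inner_adj a b.
Proof.
rewrite /inner_adj !mem_arcs.
by case/or3P => [/eqP[-> ->]|->|/eqP[-> ->]].
Qed.

Lemma petersen_adjE a b : petersen_adj a b = ((a, b) \in arcs) || ((b, a) \in arcs).
Proof.
have swap x y : ((b, a) == (x, y)) = ((a, b) == (y, x)) by rewrite !xpair_eqE andbC.
rewrite /petersen_adj /inner_adj !mem_arcs !swap.
by case: ((a, b) == (0, 1)); case: ((a, b) == (1, 0)); rewrite /= ?orbT ?orbF.
Qed.

Lemma petersen_adj_sym : symmetric petersen_adj.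
Proof. by move=> a b; rewrite !petersen_adjE orbC. Qed.

(** Symmetry is asked for on inner arcs only: 01 and 10 both occur in [arcs], so neither is ever
    looked up in reverse. *)
Lemma nth_code (g : rel nat) a b :
  (forall a b, inner_adj a b -> g a b = g b a) ->
  petersen_adj a b -> nth false (code g) (arc_index a b) = g a b.
Proof.
move=> gC; rewrite petersen_adjE /code /arc_index.
case: ifP => [ab _|/negbT nab ba]; rewrite (nth_map (0, 0)) ?index_mem ?nth_index //.
by apply: gC; apply: arcs_neq.
Qed.

Lemma sum_row (h : nat -> nat) (a : 'I_10) :
  \sum_(b < 10 | petersen_adj a b) h (arc_index a b) = row_sum h (nth [::] arc_rows a).
Proof.
rewrite -(big_mkord (petersen_adj a) (fun b => h (arc_index a b))) /arc_rows.
rewrite (nth_map 0) ?size_iota // nth_iota // /row_sum -map_comp sumnE big_map big_filter.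
by rewrite /index_iota subn0.
Qed.

Lemma sum_rows (h : nat -> nat) :
  \sum_(a < 10) \sum_(b < 10 | petersen_adj a b) h (arc_index a b)
  = sumn [seq row_sum h r | r <- arc_rows].
Proof.
under eq_bigr => a _ do rewrite sum_row.
rewrite sumnE big_map (big_nth [::]) big_mkord; exact: eq_bigr.
Qed.

Lemma petersen_cubic (a : 'I_10) : \sum_(b < 10 | petersen_adj a b) 1 = 3.
Proof.
rewrite (sum_row (fun=> 1)); case: a => a /= lta.
suff /allP/(_ a) : all (fun a => row_sum (fun=> 1) (nth [::] arc_rows a) == 3) (iota 0 10).
  by rewrite mem_iota lta => /(_ isT)/eqP.
by vm_compute.
Qed.

(** A perfect matching seen from one copy. The values at 01 and 10 are not assumed equal, because in
    [subst] they belong to two different edges. *)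
Definition local_matching (g : rel nat) : Prop :=
  (forall a b, inner_adj a b -> g a b = g b a) /\
  forall a : 'I_10, \sum_(b < 10 | petersen_adj a b) g a b = 1.

Lemma code_matching g : local_matching g -> code g \in matching_codes.
Proof.
case=> gC g1; rewrite mem_filter (mem_bitseqs (code g)) andbT.
apply/(all_nthP [::]) => a lta; have -> : a = Ordinal (lta : a < 10) by [].
rewrite -sum_row; apply/eqP; rewrite -[RHS](g1 (Ordinal (lta : a < 10))).
by apply: eq_bigr => b ab; rewrite nth_code.
Qed.

Lemma covered4 g1 g2 g3 g4 :
  local_matching g1 -> local_matching g2 -> local_matching g3 -> local_matching g4 ->
  \sum_(a < 10) \sum_(b < 10 | petersen_adj a b) [|| g1 a b, g2 a b, g3 a b | g4 a b]
  = covered [:: code g1; code g2; code g3; code g4].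
Proof.
move=> [C1 _] [C2 _] [C3 _] [C4 _]; rewrite /covered -sum_rows.
apply: eq_bigr => a _; apply: eq_bigr => b ab /=.
by rewrite !nth_code // orbF.
Qed.

Lemma covered3 g1 g2 g3 :
  local_matching g1 -> local_matching g2 -> local_matching g3 ->
  \sum_(a < 10) \sum_(b < 10 | petersen_adj a b) [|| g1 a b, g2 a b | g3 a b]
  = covered [:: code g1; code g2; code g3].
Proof.
move=> [C1 _] [C2 _] [C3 _]; rewrite /covered -sum_rows.
apply: eq_bigr => a _; apply: eq_bigr => b ab /=.
by rewrite !nth_code // orbF.
Qed.

(** Parity: if only one of 0 and 1 were matched along its outer arc, the other nine vertices would
    be matched among themselves. The check runs over the list of codes. *)
Lemma local_matching_ends g : local_matching g -> g 0 1 = g 1 0.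
Proof.
move/code_matching => gm.
have /allP/(_ _ gm)/eqP // : all (fun s => nth false s 0 == nth false s 15) matching_codes.
by vm_compute.
Qed.

(* Linear in the data of one copy, hence summable over all copies: [g 0 1] tells
   whether the edge of the base graph is matched, the last factor counts the
   ends of covered edges at the copy, and the right-hand side, up to 56, counts
   the triples of matchings that cover the edge of the base graph. *)
Lemma local_bound4 g1 g2 g3 g4 :
  local_matching g1 -> local_matching g2 -> local_matching g3 -> local_matching g4 ->
  let x1 := g1 0 1 in let x2 := g2 0 1 in let x3 := g3 0 1 in let x4 := g4 0 1 in
  x1 + x2 + x3 + x4 + 2 * ([|| x1, x2, x3 | x4] +
    \sum_(a < 10) \sum_(b < 10 | petersen_adj a b) [|| g1 a b, g2 a b, g3 a b | g4 a b])
  <= [|| x1, x2 | x3] + [|| x1, x2 | x4] + [|| x1, x3 | x4] + [|| x2, x3 | x4] + 56.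
Proof.
move=> m1 m2 m3 m4; rewrite covered4 //.
(* All quadruples of codes are tested. At most 14 edges, hence 28 ends, are covered, and 56 = 2 *
   28. Equality is attained when 0, 1 or 2 of the matchings contain 01. *)
have : all (fun s1 => all (fun s2 => all (fun s3 => all (fun s4 =>
    let x1 := nth false s1 0 in let x2 := nth false s2 0 in
    let x3 := nth false s3 0 in let x4 := nth false s4 0 in
    x1 + x2 + x3 + x4 + 2 * ([|| x1, x2, x3 | x4] + covered [:: s1; s2; s3; s4])
    <= [|| x1, x2 | x3] + [|| x1, x2 | x4] + [|| x1, x3 | x4] + [|| x2, x3 | x4] + 56)
  matching_codes) matching_codes) matching_codes) matching_codes.
  by vm_compute.
move=> /allP/(_ _ (code_matching m1))/allP/(_ _ (code_matching m2)).
by move=> /allP/(_ _ (code_matching m3))/allP/(_ _ (code_matching m4)).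
Qed.

(** Distinct perfect matchings of P share exactly one edge and no edge lies in three of them, so
    three cover at most 15 - 3 = 12 edges, with 24 ends. *)
Lemma local_bound3 g1 g2 g3 :
  local_matching g1 -> local_matching g2 -> local_matching g3 ->
  \sum_(a < 10) \sum_(b < 10 | petersen_adj a b) [|| g1 a b, g2 a b | g3 a b] <= 24.
Proof.
move=> m1 m2 m3; rewrite covered3 //.
have : all (fun s1 => all (fun s2 => all (fun s3 => covered [:: s1; s2; s3] <= 24)
  matching_codes) matching_codes) matching_codes.
  by vm_compute.
move=> /allP/(_ _ (code_matching m1))/allP/(_ _ (code_matching m2)).
by move=> /allP/(_ _ (code_matching m3)).
Qed.

(** * The Petersen graph as a cubic bridgeless graph, and its triples of matchings *)

Lemma forall_lt10 (P : rel nat) a b :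
  all (fun a => all (P a) (iota 0 10)) (iota 0 10) -> a < 10 -> b < 10 -> P a b.
Proof.
move=> /allP H a10 b10; have /H/allP : a \in iota 0 10 by rewrite mem_iota.
by apply; rewrite mem_iota.
Qed.

Lemma inner_adj_lt a b : inner_adj a b -> (a < 10) && (b < 10).
Proof.
have H : all (fun e => (e.1 < 10) && (e.2 < 10)) inner_arcs by [].
by case/orP => /(allP H) //=; rewrite andbC.
Qed.

Lemma inner_adj_sym : symmetric inner_adj.
Proof. by move=> a b; rewrite /inner_adj orbC. Qed.

Definition inner_avoid (a b : nat) : rel nat :=
  fun x y => inner_adj x y && ((x, y) \notin [:: (a, b); (b, a)]).

(** Every edge ab lies on a 5-cycle of P whose other four edges differ from 01; c, d, e are its
    remaining vertices. Avoiding 01 as well makes the detour available inside a copy. *)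
Lemma petersen_detour (a b : 'I_10) : petersen_adj a b ->
  connect (fun x y : 'I_10 => inner_avoid a b x y) a b.
Proof.
pose P x y := petersen_adj x y ==> has (fun c => has (fun d => has (fun e =>
  [&& inner_avoid x y x c, inner_avoid x y c d, inner_avoid x y d e & inner_avoid x y e y])
  (iota 0 10)) (iota 0 10)) (iota 0 10).
have H : all (fun x => all (P x) (iota 0 10)) (iota 0 10) by vm_compute.
move=> ab; have := forall_lt10 H (ltn_ord a) (ltn_ord b); rewrite /P ab implyTb.
case/hasP=> c; rewrite mem_iota => c10 /hasP[d]; rewrite mem_iota => d10.
case/hasP=> e; rewrite mem_iota => e10 /and4P[ac cd de eb].
pose step := fun x y : 'I_10 => inner_avoid a b x y.
have step1 (x y : 'I_10) : step x y -> connect step x y by exact: connect1.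
have {}ac := step1 a (Ordinal (c10 : c < 10)) ac.
have {}cd := step1 (Ordinal (c10 : c < 10)) (Ordinal (d10 : d < 10)) cd.
have {}de := step1 (Ordinal (d10 : d < 10)) (Ordinal (e10 : e < 10)) de.
have {}eb := step1 (Ordinal (e10 : e < 10)) b eb.
exact: connect_trans ac (connect_trans cd (connect_trans de eb)).
Qed.

Lemma petersen_adj_irr : irreflexive petersen_adj.
Proof.
move=> a; apply/negbTE/negP; rewrite petersen_adjE orbb.
have /allP H : all (fun e => e.1 != e.2) arcs by [].
by move/H; rewrite eqxx.
Qed.

Definition petersen : sgraph :=
  @SGraph 'I_10 (fun a b => petersen_adj a b)
    (fun a b => petersen_adj_sym a b) (fun a => petersen_adj_irr a).

Lemma petersen_degree (a : petersen) : degree a = 3.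
Proof. by rewrite degreeE -(petersen_cubic a). Qed.

Lemma petersen_cubic_bridgeless : cubic_bridgeless petersen.
Proof.
apply/cubic_bridgelessP; split=> [||a b ab].
- by rewrite card_ord.
- exact: petersen_degree.
apply: connect_sub (petersen_detour ab) => x y; rewrite /inner_avoid => /andP[xy nab].
apply: connect1; rewrite /del_edge /= /petersen_adj xy /=.
by apply: contra nab => /eqP/set2_eq; rewrite !inE !xpair_eqE !(inj_eq val_inj).
Qed.

Lemma petersen_local_matching (M : {set {set petersen}}) : perfect_matching M ->
  local_matching (fun a b => [set (inord a : petersen); inord b] \in M).
Proof.
move=> pM; have sME : M \subset edges petersen by case/andP: pM.
split=> [a b _|a]; first by rewrite setUC.
rewrite -[RHS](perfect_matchingP sME pM a); apply: eq_bigr => b _.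
by rewrite !inord_val.
Qed.

Lemma petersen_max_union3 : max_union petersen 3 <= 12.
Proof.
case: (posnP (max_union petersen 3)) => [->//|/max_union3_attained].
move=> [A [B [C [pA pB pC <-]]]].
have sE : A :|: B :|: C \subset edges petersen.
  by rewrite !subUset; case/andP: pA => ->; case/andP: pB => ->; case/andP: pC => ->.
rewrite -(leq_pmul2l (isT : 0 < 2)) -handshake //.
have /= := local_bound3 (petersen_local_matching pA) (petersen_local_matching pB)
             (petersen_local_matching pC).
apply: leq_trans; apply: eq_leq; apply: eq_bigr => a _; apply: eq_bigr => b _.
by rewrite !inord_val !inE orbA.
Qed.

Lemma card_petersen_edges : #|edges petersen| = 15.
Proof. by have := card_edges_cubic petersen_degree; rewrite card_ord; lia. Qed.

(** * Replacing edges by copies of the Petersen graph minus an edge *)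

Section Substitution.
Variable G : sgraph.

Definition dart := {p : G * G | adj p.1 p.2}.
Definition src (d : dart) : G := (val d).1.
Definition dst (d : dart) : G := (val d).2.

Lemma dart_adj (d : dart) : adj (src d) (dst d). Proof. exact: (svalP d). Qed.

Lemma flip_subproof (d : dart) : adj (dst d) (src d).
Proof. by rewrite adj_sym dart_adj. Qed.
Definition flip (d : dart) : dart := exist _ (dst d, src d) (flip_subproof d).

Lemma dart_inj (d e : dart) : src d = src e -> dst d = dst e -> d = e.
Proof.
case: d e => [[u v] uv] [[u' v'] uv']; rewrite /src /dst /= => E1 E2.
by subst; congr exist; apply: bool_irrelevance.
Qed.

Lemma flipK : involutive flip.
Proof. by move=> d; apply: dart_inj. Qed.

Lemma flip_neq d : flip d != d.
Proof.
apply/eqP => /(congr1 src) E; have := dart_adj d.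
by rewrite -[dst d]/(src (flip d)) E adj_irr.
Qed.

Lemma sum_src u (F : G -> nat) :
  \sum_(d | src d == u) F (dst d) = \sum_(v | adj u v) F v.
Proof.
rewrite [RHS](eq_bigl (mem (dst @: [set d | src d == u]))) => [|v /=].
  rewrite big_imset /= => [|d e]; first by apply: eq_bigl => d; rewrite inE.
  by rewrite !inE => /eqP du /eqP eu; apply: dart_inj; rewrite du eu.
apply/idP/imsetP => [uv|[d]]; last by rewrite inE => /eqP <- ->; apply: dart_adj.
by exists (exist _ (u, v) uv); rewrite ?inE.
Qed.

Lemma sum_darts (F : dart -> nat) : \sum_u \sum_(d | src d == u) F d = \sum_d F d.
Proof. by rewrite (partition_big src xpredT) //. Qed.

Lemma dart_handshake (S : {set {set G}}) : S \subset edges G ->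
  \sum_(d : dart) ([set src d; dst d] \in S) = 2 * #|S|.
Proof.
move/handshake <-; rewrite -sum_darts; apply: eq_bigr => u _.
rewrite -(sum_src u (fun v => ([set u; v] \in S) : nat)).
by apply: eq_bigr => d /eqP ->.
Qed.

Lemma card_dart : #|{: dart}| = 2 * #|edges G|.
Proof.
rewrite -(dart_handshake (subxx _)) -sum1_card; apply: eq_bigr => d _.
by rewrite mem_edges dart_adj.
Qed.

(* Each dart of [G] owns a copy of the Petersen graph minus the arc 01, so that
   an edge of [G] carries two copies and no orientation has to be chosen. *)
Definition subst_vertex : finType := (G + dart * 'I_10)%type.

(** The chain for uv runs from u through the copy of the dart uv and the copy of the dart vu to v:
    vertex 0 of a copy faces its source, vertex 1 faces the reversed dart. *)
Definition subst_adj : rel subst_vertex := fun x y =>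
  match x, y with
  | inl _, inl _ => false
  | inl u, inr (d, a) | inr (d, a), inl u => (src d == u) && (a == 0 :> nat)
  | inr (d, a), inr (e, b) =>
      (d == e) && inner_adj a b || [&& e == flip d, a == 1 :> nat & b == 1 :> nat]
  end.

Lemma inner_adj_irr : irreflexive inner_adj.
Proof. by move=> a; have := petersen_adj_irr a; rewrite /petersen_adj; case: inner_adj. Qed.

Lemma subst_adj_sym : symmetric subst_adj.
Proof.
move=> [u|[d a]] [v|[e b]] //=; rewrite eq_sym inner_adj_sym; congr (_ || _).
by rewrite (andbC (a == _ :> nat)) -(inj_eq (inv_inj flipK)) flipK eq_sym.
Qed.

Lemma subst_adj_irr : irreflexive subst_adj.
Proof. by move=> [u|[d a]] //=; rewrite inner_adj_irr andbF eq_sym (negbTE (flip_neq d)). Qed.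

Definition subst : sgraph := SGraph subst_adj_sym subst_adj_irr.

(* The neighbour of [(d, a)] that stands for the neighbour [b] of [a] in the
   Petersen graph: the removed arc 01 leads out of the copy [d]. *)
Definition port (d : dart) (a b : 'I_10) : subst :=
  if (nat_of_ord a, nat_of_ord b) == (0, 1) then inl (src d)
  else if (nat_of_ord a, nat_of_ord b) == (1, 0) then inr (flip d, a) else inr (d, b).

Lemma port_inj d (a : 'I_10) : {in [pred b : 'I_10 | petersen_adj a b] &, injective (port d a)}.
Proof.
move=> b c; rewrite !inE /port !xpair_eqE => ab ac.
case: (boolP (_ && _)) => [/andP[/eqP a0 /eqP b1]|_].
  rewrite a0 /=; case: eqP => // c1 _; apply: val_inj; by rewrite /= b1 c1.
case: (boolP (_ && _)) => [/andP[/eqP a1 /eqP b0]|_].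
  rewrite a1 /=; case: eqP => [c0 _|_ []]; first by apply: val_inj; rewrite /= b0 c0.
  by move/eqP; rewrite (negbTE (flip_neq d)).
case: ifP => // _; case: ifP => [_ [/esym/eqP]|_ []//].
by rewrite (negbTE (flip_neq d)).
Qed.

Lemma adj_port d (a : 'I_10) (y : subst) :
  subst_adj (inr (d, a)) y = (y \in port d a @: [set b : 'I_10 | petersen_adj a b]).
Proof.
apply/idP/imsetP => [|[b]]; last first.
  rewrite inE /port => ab ->; case: ifP => [/eqP[a0 _]|n01]; first by rewrite /= a0 !eqxx.
  case: ifP => [/eqP[a1 _]|n10]; first by rewrite /= a1 !eqxx orbT.
  by move: ab; rewrite /petersen_adj n01 n10 !orbF /= eqxx => ->.
case: y => [u|[e b]] /=.
  case/andP => /eqP <- /eqP a0; have b1 : (inord 1 : 'I_10) = 1 :> nat by rewrite inordK.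
  by exists (inord 1); [rewrite inE a0 b1 | rewrite /port a0 b1].
case/orP => [/andP[/eqP <- ab]|/and3P[/eqP -> /eqP a1 /eqP b1]].
  exists b; first by rewrite inE /petersen_adj ab.
  rewrite /port; case: ifP => [/eqP[a0 b1]|_]; first by rewrite a0 b1 in ab.
  by case: ifP => [/eqP[a0 b1]|_] //; rewrite a0 b1 in ab.
exists ord0; first by rewrite inE a1.
by rewrite /port a1 /=; congr (inr (_, _)); apply: val_inj; rewrite /= a1 b1.
Qed.

(** Through [port], the neighbourhood of a vertex of a copy is that of a vertex of P, so degree and
    matching conditions reduce to P. *)
Lemma sum_copy d (a : 'I_10) (F : subst -> nat) :
  \sum_(y | subst_adj (inr (d, a)) y) F y
  = \sum_(b < 10 | petersen_adj a b) F (port d a b).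
Proof.
rewrite (eq_bigl (mem (port d a @: [set b : 'I_10 | petersen_adj a b]))) => [|y]; last exact: adj_port.
rewrite big_imset /= => [|b c]; first by apply: eq_bigl => b; rewrite inE.
by rewrite !inE => ab ac; apply: port_inj; rewrite inE.
Qed.

Lemma sum_hub u (F : subst -> nat) :
  \sum_(y | subst_adj (inl u) y) F y = \sum_(d | src d == u) F (inr (d, ord0)).
Proof.
pose f d : subst := inr (d, ord0).
rewrite (eq_bigl (mem (f @: [set d | src d == u]))) => [|y].
  by rewrite big_imset /= => [|d e _ _ []//]; apply: eq_bigl => d; rewrite inE.
apply/idP/imsetP => [|[d]]; last by rewrite inE => /eqP <- -> /=; rewrite eqxx.
case: y => [//|[d a]] /andP[/eqP <- /eqP a0]; exists d; rewrite ?inE //.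
by congr (inr (_, _)); apply: val_inj.
Qed.

Lemma sum_subst (F : subst -> nat) :
  \sum_x F x = \sum_u F (inl u) + \sum_d \sum_(a < 10) F (inr (d, a)).
Proof. by rewrite big_sumType /= pair_big /=; congr (_ + _); apply: eq_bigr => -[]. Qed.

End Substitution.

(** * The substituted graph is cubic and bridgeless *)

Lemma connect_map (T T' : finType) (e : rel T) (e' : rel T') (f : T -> T') x y :
  (forall x y, e x y -> connect e' (f x) (f y)) -> connect e x y -> connect e' (f x) (f y).
Proof.
move=> ee' /connectP[p + ->]; elim: p x => [|z p IH] x /=; first by rewrite connect0.
by case/andP => /ee' xz /IH; apply: connect_trans.
Qed.

Lemma del_edgeI (G : sgraph) (s t x y : G) :
  adj x y -> (x, y) <> (s, t) -> (x, y) <> (t, s) -> del_edge s t x y.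
Proof.
move=> xy n1 n2; rewrite /del_edge xy; apply/negP => /eqP/set2_eq.
by rewrite !inE => /orP[]/eqP.
Qed.

Lemma connect_del_edge_swap (G : sgraph) (x y : G) :
  connect (del_edge x y) x y -> connect (del_edge y x) y x.
Proof.
rewrite del_edge_sym => c; rewrite (_ : connect _ y x = connect (del_edge x y) y x) //.
by apply: eq_connect => a b; rewrite /del_edge (setUC [set y]).
Qed.

Section Bridgeless.
Variable G : sgraph.
Hypothesis G_cubic : cubic_bridgeless G.
Local Notation H := (subst G).
Local Notation hub u := (inl u : H).
Local Notation copy d a := (inr (d, a) : H).
Implicit Types (d e : dart G) (a b : 'I_10).

Let o1 : 'I_10 := Ordinal (isT : 1 < 10).

Lemma subst_degree (x : H) : degree x = 3.
Proof.
rewrite degreeE; case: x => [u|[d a]].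
  have [_ G3 _] := G_cubic.
  by rewrite (sum_hub u (fun=> 1)) (sum_src u (fun=> 1)) -degreeE.
by rewrite (sum_copy d a (fun=> 1)) petersen_cubic.
Qed.

Lemma connect_copy (R : rel H) d a b : petersen_adj a b ->
  (forall x y : 'I_10, inner_avoid a b x y -> R (copy d x) (copy d y)) ->
  connect R (copy d a) (copy d b).
Proof.
move=> ab RH; apply: (connect_map (f := fun x => copy d x)) (petersen_detour ab) => x y xy.
exact/connect1/RH.
Qed.

(** Only edges of the chain of [d] are required in [R], so [R] may lack an edge of another chain.
    Each copy is crossed by the detour for 01. *)
Lemma connect_cross (R : rel H) d :
  R (hub (src d)) (copy d ord0) ->
  (forall x y : 'I_10, inner_adj x y -> R (copy d x) (copy d y)) ->
  R (copy d o1) (copy (flip d) o1) ->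
  (forall x y : 'I_10, inner_adj x y -> R (copy (flip d) x) (copy (flip d) y)) ->
  R (copy (flip d) ord0) (hub (dst d)) ->
  connect R (hub (src d)) (hub (dst d)).
Proof.
move=> r1 r2 r3 r4 r5; apply: connect_trans (connect1 r1) _.
apply: (connect_trans (y := copy d o1)).
  by apply: connect_copy => // x y /andP[xy _]; apply: r2.
apply: connect_trans (connect1 r3) _; apply: connect_trans (connect1 r5).
by apply: connect_copy => // x y /andP[xy _]; apply: r4.
Qed.

(** All hubs count as near, since a deleted edge of the chain may end in one. Hubs are pairwise
    non-adjacent, so an edge of another chain still has an end that is not near. *)
Definition near d (x : H) : bool :=
  if x is inr (e, _) then (e == d) || (e == flip d) else true.

Lemma del_edge_far d (s t x y : H) : near d s -> near d t -> ~~ (near d x && near d y) ->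
  adj x y -> del_edge s t x y.
Proof.
by move=> ns nt nxy xy; apply: del_edgeI => // -[ex ey]; rewrite ex ey ns nt in nxy.
Qed.

(** A detour in G around the edge of [d] lifts to H edge by edge; the chains it crosses belong to
    other edges and survive the deletion of [s t]. *)
Lemma connect_hubs d (s t : H) : near d s -> near d t ->
  connect (del_edge s t) (hub (src d)) (hub (dst d)).
Proof.
move=> ns nt; have [_ _ /(_ _ _ (dart_adj d))] := (cubic_bridgelessP G).1 G_cubic.
apply: (connect_map (f := fun u : G => hub u)) => u v /andP[uv nuv].
pose e : dart G := exist _ (u, v) uv.
have /negbTE ne : ~~ ((e == d) || (e == flip d)).
  apply: contra nuv => /orP[]/eqP E; rewrite -[u]/(src e) -[v]/(dst e) E //.
  by rewrite setUC.
have /negbTE nf : ~~ ((flip e == d) || (flip e == flip d)).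
  by rewrite (inj_eq (inv_inj (@flipK G))) -(inj_eq (inv_inj (@flipK G))) flipK orbC ne.
apply: (connect_cross (d := e)) => [|x y xy||x y xy|]; apply: del_edge_far ns nt _ _;
  by rewrite /= ?ne ?nf ?eqxx ?xy ?andbF.
Qed.

(** Three kinds of edges: an edge at a hub or between the two copies of a chain lies on the closed
    walk made of that chain and a lifted detour of G; an edge inside a copy has a detour in that
    copy. *)
Lemma subst_cubic_bridgeless : cubic_bridgeless H.
Proof.
apply/cubic_bridgelessP; split; last 1 first.
- have hub_case d : connect (del_edge (hub (src d)) (copy d ord0)) (hub (src d)) (copy d ord0).
    have nd : near d (copy d ord0) by rewrite /= eqxx.
    have nf := flip_neq d.
    apply: connect_trans (connect_hubs (d := d) (s := hub (src d)) isT nd) _.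
    apply: (connect_trans (y := copy (flip d) ord0)).
      apply/connect1/del_edgeI; rewrite ?inE //=; first by rewrite !eqxx.
      by case=> _ E; rewrite E eqxx in nf.
    apply: (connect_trans (y := copy (flip d) o1)).
      apply: connect_copy => // x y /andP[xy _]; apply: del_edgeI => //.
      by rewrite /= xy eqxx.
    apply: (connect_trans (y := copy d o1)).
      apply/connect1/del_edgeI => //; first by rewrite /= flipK !eqxx orbT.
    apply: connect_copy => // x y /andP[xy _]; apply: del_edgeI => //.
    by rewrite /= xy eqxx.
  have mid_case d : connect (del_edge (copy d o1) (copy (flip d) o1)) (copy d o1) (copy (flip d) o1).
    have nf := flip_neq d.
    apply: (connect_trans (y := copy d ord0)).
      apply: connect_copy => // x y /andP[xy _]; apply: del_edgeI.
      + by rewrite /= xy eqxx.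
      + by case=> _ E; rewrite -E eqxx in nf.
      + by case=> E; rewrite -E eqxx in nf.
    apply: (connect_trans (y := hub (src d))).
      by apply/connect1/del_edgeI => //; rewrite /= !eqxx.
    apply: (connect_trans (y := hub (dst d))).
      by apply: (connect_hubs (d := d)); rewrite /= eqxx ?orbT.
    apply: (connect_trans (y := copy (flip d) ord0)).
      by apply/connect1/del_edgeI => //; rewrite /= !eqxx.
    apply: connect_copy => // x y /andP[xy _]; apply: del_edgeI.
    + by rewrite /= xy eqxx.
    + by case=> E; rewrite E eqxx in nf.
    + by case=> _ E; rewrite E eqxx in nf.
  case=> [u|[d a]] [v|[e b]] //= => [/andP[/eqP <- /eqP b0]|/andP[/eqP <- /eqP a0]|].
  + by rewrite (_ : b = ord0) //; apply: val_inj.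
  + have -> : a = ord0 by apply: val_inj.
    exact: (@connect_del_edge_swap H _ _ (hub_case d)).
  case/orP => [/andP[/eqP <- ab]|/and3P[/eqP -> /eqP a1 /eqP b1]]; last first.
    have -> : a = o1 by apply: val_inj.
    by have -> : b = o1 by apply: val_inj.
  apply: connect_copy => [|x y]; first by rewrite /petersen_adj ab.
  case/andP=> xy nab; apply: del_edgeI; first by rewrite /= xy eqxx.
  + by case=> E1 E2; rewrite E1 E2 !inE eqxx in nab.
  + by case=> E1 E2; rewrite E1 E2 !inE eqxx orbT in nab.
- have [/card_gt0P[u _] _ _] := G_cubic.
  by apply/card_gt0P; exists (hub u).
- exact: subst_degree.
Qed.

End Bridgeless.

(** * Projection of perfect matchings from the substituted graph to G *)

Section Matchings.
Variable G : sgraph.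
Local Notation H := (subst G).
Local Notation hub u := (inl u : H).
Local Notation copy d a := (inr (d, a) : H).
Implicit Types (d e : dart G) (M : {set {set H}}).

(** Because of [port], the entries 01 and 10 describe the two edges that leave the copy. *)
Definition copy_matching M d : rel nat :=
  fun a b => [set copy d (inord a); port d (inord a) (inord b)] \in M.

Definition mark M d : bool := [set hub (src d); copy d ord0] \in M.

Definition project M : {set {set G}} := [set [set src d; dst d] | d in mark M].

Lemma port_inner d (a b : 'I_10) : inner_adj a b -> port d a b = copy d b.
Proof.
move=> ab; rewrite /port; case: eqP => [[a0 b1]|_]; first by rewrite a0 b1 in ab.
by case: eqP => // -[a1 b0]; rewrite a1 b0 in ab.
Qed.

Lemma copy_matching_local M d : perfect_matching M -> local_matching (copy_matching M d).
Proof.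
move=> pM; have sME : M \subset edges H by case/andP: pM.
split=> [a b ab|a].
  have /andP[a10 b10] := inner_adj_lt ab; rewrite /copy_matching.
  by rewrite !port_inner ?inordK // 1?inner_adj_sym // setUC.
have := perfect_matchingP sME pM (copy d a).
rewrite (sum_copy d a (fun y => ([set copy d a; y] \in M) : nat)) => E.
by rewrite -[RHS]E; apply: eq_bigr => b _; rewrite /copy_matching !inord_val.
Qed.

Lemma copy_matching01 M d : copy_matching M d 0 1 = mark M d.
Proof.
rewrite /copy_matching /port !inordK //= /mark setUC.
by have -> : inord 0 = ord0 :> 'I_10 by apply: val_inj; rewrite /= inordK.
Qed.

(** Parity makes the two edges leaving a copy agree in [M], and the two copies of a chain share the
    edge between their vertices 1. *)
Lemma mark_flip M d : perfect_matching M -> mark M (flip d) = mark M d.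
Proof.
move=> pM; rewrite -!copy_matching01 !(local_matching_ends (copy_matching_local _ pM)).
by rewrite /copy_matching /port !inordK //= flipK setUC.
Qed.

Lemma mem_project M d : perfect_matching M -> ([set src d; dst d] \in project M) = mark M d.
Proof.
move=> pM; apply/imsetP/idP => [[e me]|md]; last by exists d.
move/set2_eq; rewrite !inE => /orP[]/eqP[sd dd].
  by rewrite (dart_inj sd dd).
by rewrite (_ : d = flip e) ?mark_flip //; apply: dart_inj.
Qed.

Lemma project_sub M : project M \subset edges G.
Proof. by apply/fintype.subsetP => _ /imsetP[d _ ->]; rewrite mem_edges dart_adj. Qed.

Lemma sum_mark M u : perfect_matching M -> \sum_(d | src d == u) mark M d = 1.
Proof.
move=> pM; have sME : M \subset edges H by case/andP: pM.
have := perfect_matchingP sME pM (hub u).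
rewrite (sum_hub u (fun y => ([set hub u; y] \in M) : nat)) => E.
by rewrite -[RHS]E; apply: eq_bigr => d /eqP <-.
Qed.

Lemma project_matching M : perfect_matching M -> perfect_matching (project M).
Proof.
move=> pM; apply/perfect_matchingP => [|u]; first exact: project_sub.
rewrite -(sum_src u (fun v => ([set u; v] \in project M) : nat)) -(sum_mark u pM).
by apply: eq_bigr => d /eqP <-; rewrite mem_project.
Qed.

(** Each edge of G is counted by its two darts, whence the factor 2. *)
Lemma sum_mark3 M1 M2 M3 :
  perfect_matching M1 -> perfect_matching M2 -> perfect_matching M3 ->
  \sum_d [|| mark M1 d, mark M2 d | mark M3 d] <= 2 * max_union G 3.
Proof.
move=> p1 p2 p3; have := max_union3_ge (project_matching p1) (project_matching p2) (project_matching p3).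
rewrite -(leq_pmul2l (isT : 0 < 2)) -dart_handshake ?subUset ?project_sub //.
apply: leq_trans; apply: eq_leq; apply: eq_bigr => d _.
by rewrite !in_setU !mem_project // orbA.
Qed.

(** The local bound is summed over all darts for four optimal matchings of H; each of the four
    triples among them projects to three perfect matchings of G. *)
Lemma max_union3_of_subst : cubic_bridgeless G ->
  14 * #|edges H| <= 15 * max_union H 4 -> 4 * #|edges G| <= 5 * max_union G 3.
Proof.
move=> Gc le4; have [G0 G3 _] := Gc.
have cE := card_edges_cubic G3.
have cH := card_edges_cubic (subst_degree Gc).
have cV : #|H| = #|G| + 10 * (3 * #|G|).
  by rewrite card_sum card_prod card_ord card_dart cE mulnC.
have mH0 : 0 < max_union H 4 by lia.
have [M1 [M2 [M3 [M4 [p1 p2 p3 p4 cU]]]]] := max_union4_attained mH0.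
set U := _ :|: M4 in cU.
have sU : U \subset edges H.
  by rewrite !subUset; case/andP: p1 => ->; case/andP: p2 => ->; case/andP: p3 => ->; case/andP: p4 => ->.
have sumM M : perfect_matching M -> \sum_d mark M d = #|G|.
  move=> pM; rewrite -sum_darts -sum1_card; apply: eq_bigr => u _; exact: sum_mark.
(* Ends of covered edges at hubs are one per dart marked by some matching; those at copies take the
   form of the local bound. *)
have := handshake sU; rewrite cU sum_subst.
under eq_bigr => u _ do rewrite (sum_hub u (fun y => ([set hub u; y] \in U) : nat)).
rewrite [X in X + _ = _](_ : _ = \sum_d [|| mark M1 d, mark M2 d, mark M3 d | mark M4 d]); last first.
  rewrite -sum_darts; apply: eq_bigr => u _; apply: eq_bigr => d /eqP <-.
  by rewrite !in_setU /mark !orbA.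
under [X in _ + X]eq_bigr => d _ do under eq_bigr => a _ do
  rewrite (sum_copy d a (fun y => ([set copy d a; y] \in U) : nat)).
move=> E.
have : \sum_d (mark M1 d + mark M2 d + mark M3 d + mark M4 d +
  2 * ([|| mark M1 d, mark M2 d, mark M3 d | mark M4 d] +
       \sum_(a < 10) \sum_(b < 10 | petersen_adj a b) ([set copy d a; port d a b] \in U)))
  <= \sum_d ([|| mark M1 d, mark M2 d | mark M3 d] + [|| mark M1 d, mark M2 d | mark M4 d]
     + [|| mark M1 d, mark M3 d | mark M4 d] + [|| mark M2 d, mark M3 d | mark M4 d] + 56).
  apply: leq_sum => d _.
  have := local_bound4 (copy_matching_local d p1) (copy_matching_local d p2)
                       (copy_matching_local d p3) (copy_matching_local d p4).
  rewrite /= !copy_matching01; apply: leq_trans; apply: eq_leq; congr (_ + 2 * (_ + _)).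
  apply: eq_bigr => a _; apply: eq_bigr => b _.
  by rewrite /copy_matching !inord_val !in_setU !orbA.
rewrite !big_split /= !sumM // E !sum_nat_const card_dart.
have h123 := sum_mark3 p1 p2 p3; have h124 := sum_mark3 p1 p2 p4.
have h134 := sum_mark3 p1 p3 p4; have h234 := sum_mark3 p2 p3 p4.
(* With m = |E(G)|: |V(G)| = 2m/3, |E(H)| = 31m, and the union U has at least 434m/15 edges. Then
   4|V(G)| + 4|U| <= 8 [max_union G 3] + 112m gives [max_union G 3] >= 4m/5. *)
move=> le; have := leq_trans le (leq_add (leq_add (leq_add (leq_add h123 h124) h134) h234) (leqnn _)).
move: cE cH cV le4; move: #|edges G| #|edges H| #|G| #|H| (max_union G 3) (max_union H 4).
clear; lia.
Qed.

End Matchings.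

(** * Comparison of the infima *)

Local Open Scope ring_scope.

Lemma m_inf_le (R : realType) (t : nat) (G : sgraph) :
  cubic_bridgeless G -> m_inf R t <= m_graph R t G.
Proof.
move=> Gc; apply: ge_inf; last by exists G.
by exists 0 => _ [K _ ->]; rewrite divr_ge0.
Qed.

Lemma edges_gt0 (G : sgraph) : cubic_bridgeless G -> (0 < #|edges G|)%N.
Proof. by case=> G0 G3 _; have := card_edges_cubic G3; lia. Qed.

Theorem theorem9 (R : realType) :
  m_inf R 4 = 14%:R / 15%:R -> m_inf R 3 = 4%:R / 5%:R.
Proof.
move=> m4; apply/eqP; rewrite eq_le; apply/andP; split.
  apply: le_trans (m_inf_le R 3 petersen_cubic_bridgeless) _.
  rewrite /m_graph card_petersen_edges ler_pdivrMr // mulrAC ler_pdivlMr //.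
  rewrite -!natrM ler_nat; have := petersen_max_union3; lia.
apply: lb_le_inf; first by exists (m_graph R 3 petersen); exists petersen => //; exact: petersen_cubic_bridgeless.
move=> _ [G Gc ->]; have E0 := edges_gt0 Gc.
rewrite /m_graph ler_pdivlMr ?ltr0n // mulrAC ler_pdivrMr // -!natrM ler_nat [(_ * 5)%N]mulnC.
apply: max_union3_of_subst => //.
(* The value of m_4 bounds the ratio of the substituted graph from below by 14/15. *)
have := m_inf_le R 4 (subst_cubic_bridgeless Gc); rewrite m4 /m_graph.
rewrite ler_pdivlMr ?ltr0n ?edges_gt0 //; last exact: subst_cubic_bridgeless.
by rewrite mulrAC ler_pdivrMr // -!natrM ler_nat [(_ * 15)%N]mulnC.
Qed.
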